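(* There is an absolute constant $n_0$ such that the following holds. Let $T$ be a tree with $n\ge n_0$ vertices and maximum degree $\Delta$. Suppose that $T$ has at least $n/(\log n)^3$ leaves and let $v$ be an arbitrary vertex of $T$. Let $G$ be an $n$-vertex graph with $\delta(G)\ge n-n/(\Delta(\log n)^5)$ and let $x\in V(G)$. If $p\ge\Delta(\log n)^5/n$, then with probability at least $1-n^{-4}$ there is an embedding of $T$ into $G_p$ that maps $v$ to $x$.
   Context: For a graph $G$ and $p\in[0,1]$, $G_p$ is the random subgraph of $G$ obtained by keeping each edge independently with probability $p$. An embedding of $T$ into $H$ is an injective map $V(T)\to V(H)$ sending edges to edges. $\log$ denotes the natural logarithm. *)

(* Defs.v *)
From HB Require Import structures.
From mathcomp Require Import all_boot all_order all_algebra.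
From mathcomp Require Import reals exp.

Set Implicit Arguments.
Unset Strict Implicit.
Unset Printing Implicit Defensive.

Import Order.TTheory GRing.Theory Num.Theory.
Local Open Scope ring_scope.

Record sgraph (V : finType) := SGraph {
  adj :> rel V;
  adj_sym : symmetric adj;
  adj_irrefl : irreflexive adj }.

Section Graph.
Variables (V : finType) (G : sgraph V).

Definition degree (x : V) : nat := #|[set y | G x y]|.

Definition max_degree : nat := (\max_(x : V) degree x)%N.

(* Every degree is less than #|V|, so the default value #|V| does not affect
   the minimum when V is nonempty. *)
Definition min_degree : nat := \big[minn/#|V|]_(x : V) degree x.

Definition leaves : {set V} := [set x | degree x == 1%N].

Definition connected : Prop := (0 < #|V|)%N /\ forall x y : V, connect G x y.

(* [ucycle G [:: x; y]] holds for every edge xy, hence the size condition. *)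
Definition acyclic : Prop := forall c : seq V, (2 < size c)%N -> ~ ucycle G c.

Definition tree : Prop := connected /\ acyclic.

Definition edges : {set {set V}} :=
  [set [set xy.1; xy.2] | xy : V * V & G xy.1 xy.2].

Definition subgraph_adj (F : {set {set V}}) : rel V :=
  [rel x y | G x y && ([set x; y] \in F)].

Lemma subgraph_adj_sym F : symmetric (subgraph_adj F).
Proof. by move=> x y; rewrite /subgraph_adj /= adj_sym setUC. Qed.

Lemma subgraph_adj_irrefl F : irreflexive (subgraph_adj F).
Proof. by move=> x; rewrite /subgraph_adj /= adj_irrefl. Qed.

Definition subgraph (F : {set {set V}}) : sgraph V :=
  SGraph (subgraph_adj_sym F) (subgraph_adj_irrefl F).

End Graph.

Definition embedding (U V : finType) (T : sgraph U) (H : sgraph V)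
    (f : {ffun U -> V}) : bool :=
  injectiveb f && [forall y, forall z, T y z ==> H (f y) (f z)].

Section RandomSubgraph.
Variables (R : realType) (V : finType) (G : sgraph V) (p : R).

(* The probability that F is the set of kept edges, for F \subset edges G:
   the product over the edges of independent Bernoulli(p) weights. *)
Definition kept_prob (F : {set {set V}}) : R :=
  \prod_(e in edges G) (if e \in F then p else 1 - p).

(* The probability that the random subgraph G_p satisfies A. *)
Definition Gp_prob (A : pred (sgraph V)) : R :=
  \sum_(F in powerset (edges G) | A (subgraph G F)) kept_prob F.

(* Each set S of edges is kept with probability p ^+ #|S|; for S = set0 this
   says that the total mass is 1. *)
Lemma kept_prob_superset (S : {set {set V}}) : S \subset edges G ->
  \sum_(F in powerset (edges G) | S \subset F) kept_prob F = p ^+ #|S|.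
Proof.
move=> sSE; set E := edges G.
pose f e : R := if e \in E then p else 0.
pose g e : R := if e \in S then 0 else if e \in E then 1 - p else 1.
have -> : p ^+ #|S| = \prod_e (f e + g e).
  rewrite -prodr_const big_mkcond; apply: eq_bigr => e _; rewrite /f /g.
  have := subsetP sSE e; case: (e \in S) => [->//|_]; first by rewrite addr0.
  by case: ifP; rewrite ?add0r // addrC subrK.
rewrite bigA_distr big_mkcond /=; apply: eq_bigr => F _.
rewrite powersetE; case: ifP => [/andP[sFE sSF]|].
  rewrite /kept_prob big_mkcond; apply: eq_bigr => e _; rewrite /f /g.
  have := subsetP sFE e; have := subsetP sSF e; rewrite -/E.
  case: (e \in F) => [_ ->//|]; case: (e \in S) => [/(_ isT)//|].
  by case: ifP.
move/negbT; rewrite negb_and => /orP[] /subsetPn[e e1 e2].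
  by rewrite (bigD1 e) //= e1 /f (negPf e2) mul0r.
by rewrite (bigD1 e) //= (negPf e2) /g e1 mul0r.
Qed.

End RandomSubgraph.

(* Main.v *)
Require Import Defs.
From HB Require Import structures.
From mathcomp Require Import all_boot all_order all_algebra.
From mathcomp Require Import reals sequences exp.
From mathcomp Require Import ring lra zify.

(* Let L be the set of leaves of T other than v, and write G_p as the union of
   two independent copies of G_q, where (1 - q) ^ 2 = 1 - p, so that q >= p / 2.

   The first copy is used to embed T - L greedily from v |-> x: the images of
   all the children of a vertex t are chosen at once among the neighbours of
   f(t) that are still free. At that time no edge from f(t) to a free vertex has
   been exposed, and at least #|L| >= n / (log n) ^ 3 - 1 vertices are free, so
   fewer than Delta of them are neighbours of f(t) with probability at most
   n ^ -6.

   The second copy is used to match L with the remaining vertices B. If Hall's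
   condition fails, there are a set S of parents of leaves and a set Z in B with
   #|Z| < Delta * #|S|, no edge between f(S) and B - Z, and fewer than
   #|B - Z| parents outside S. If #|Z| <= #|B| / 2, the probability of this is
   at most y ^ (#|S| + #|Z|) with y = n ^ -8; otherwise S is large, and the
   probability is at most y ^ (#|B - Z| + #|parents - S|). Both bounds are
   summed over all pairs of sets. *)

Set Implicit Arguments.
Unset Strict Implicit.
Unset Printing Implicit Defensive.

(** * Hall's theorem and orderings of trees *)

Section Hall.
Variables A B : finType.
Implicit Types (D X : {set A}) (N : A -> {set B}).

Let cond N D := forall X, X \subset D -> #|X| <= #|\bigcup_(a in X) N a|.

Let drop N a b : A -> {set B} := fun c => if c == a then N a :\ b else N c.

(* If neither b1 nor b2 can be dropped from N a, the violators X1 and X2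
   contradict the submodularity of [X |-> #|\bigcup_(c in X) N c|]. *)
Let cond_drop N D a b1 b2 : cond N D -> a \in D ->
  b1 \in N a -> b2 \in N a -> b1 != b2 ->
  exists b, b \in N a /\ cond (drop N a b) D.
Proof.
move=> condN aD b1N b2N b12.
have [/existsP[b /andP[bN /forallP bD]]|/existsPn none] := boolP
    [exists b, (b \in N a) && [forall X : {set A}, (X \subset D) ==>
      (#|X| <= #|\bigcup_(c in X) drop N a b c|)]].
  by exists b; split=> // X XD; have := bD X; rewrite XD.
have viol b : b \in N a -> exists X : {set A}, [/\ X \subset D, a \notin X &
    #|(N a :\ b) :|: \bigcup_(c in X) N c| <= #|X|].
  move=> bN; have /existsP[X] : [exists X : {set A}, (X \subset D) &&
     (#|\bigcup_(c in X) drop N a b c| < #|X|)].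
    apply: contraT => /existsPn noX; have /negP[] := none b.
    rewrite bN; apply/forallP => X; apply/implyP => XD.
    by have := noX X; rewrite XD /= -leqNgt.
  case/andP=> XD ltX; exists (X :\ a).
  have dropN (Y : {set A}) : a \notin Y ->
      \bigcup_(c in Y) drop N a b c = \bigcup_(c in Y) N c.
    move=> aY; apply: eq_bigr => c cY; rewrite /drop.
    by case: eqP => // ca; rewrite -ca cY in aY.
  have aX : a \in X.
    apply: contraTT ltX => aX; rewrite -leqNgt dropN //; exact: condN.
  split; first exact: subset_trans (subsetDl _ _) XD.
    by rewrite !inE eqxx.
  move: ltX; rewrite (big_setD1 a aX) /= dropN ?inE ?eqxx //.
  by rewrite /drop eqxx [#|X|](cardsD1 a) aX ltnS.
have [X1 [X1D aX1 le1]] := viol _ b1N; have [X2 [X2D aX2 le2]] := viol _ b2N.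
pose M X := \bigcup_(c in X) N c.
have MU X Y : M (X :|: Y) = M X :|: M Y by rewrite /M bigcup_setU.
have MI X Y : M (X :&: Y) \subset M X :&: M Y.
  rewrite subsetI; apply/andP; split; apply/bigcupsP => c; rewrite inE => /andP[cX cY];
  exact: bigcup_sup.
(* As [b1 != b2], the two punctured copies of [N a] together cover [N a], so the condition for
   [a |: (X1 :|: X2)] applies and gains one. *)
have cU : #|X1 :|: X2|.+1 <= #|((N a :\ b1) :|: M X1) :|: ((N a :\ b2) :|: M X2)|.
  have -> : #|X1 :|: X2|.+1 = #|a |: (X1 :|: X2)|.
    by rewrite cardsU1 !inE negb_or aX1 aX2.
  apply: leq_trans (condN _ _) _; first by rewrite !subUset sub1set aD X1D.
  apply: subset_leq_card; rewrite -/(M _) !MU /M big_set1 -/(M _) -/(M X2).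
  apply/subsetP => b; rewrite !inE; case: (b \in M X1); rewrite ?orbT //.
  case: (b \in M X2); rewrite ?orbT // !orbF => ->; rewrite !andbT.
  by rewrite -negb_and; apply: contraNN b12 => /andP[/eqP<- /eqP<-].
have cI : #|X1 :&: X2| <= #|((N a :\ b1) :|: M X1) :&: ((N a :\ b2) :|: M X2)|.
  apply: leq_trans (condN _ _) _; first exact: subset_trans (subsetIl _ _) X1D.
  apply: subset_leq_card; apply: subset_trans (MI _ _) _.
  by rewrite setISS ?subsetUr.
have := leq_add cU cI; rewrite addSn !cardsUI ltnNge.
by rewrite leq_add.
Qed.

(** Elements are deleted from the sets [N a] as long as the condition survives. Once all of them are
    singletons, the condition for pairs makes these disjoint. A nonempty [D] supplies the default
    value [b0] of [f] outside [D]. *)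
Lemma hall_marriage N D : 0 < #|D| ->
  (forall X, X \subset D -> #|X| <= #|\bigcup_(a in X) N a|) ->
  exists f : A -> B, {in D &, injective f} /\ forall a, a \in D -> f a \in N a.
Proof.
move=> D0; have [k] := ubnP (\sum_(a in D) #|N a|).
elim: k N => // k IH N; rewrite ltnS => leNk condN.
have [/existsP[a /andP[aD gt1]]|/existsPn le1] := boolP
    [exists a, (a \in D) && (1 < #|N a|)].
  have /card_gt1P[b1 [b2 [b1N b2N b12]]] := gt1.
  have [b [bN condb]] := cond_drop condN aD b1N b2N b12.
  have [||f [finj fN]] := IH (drop N a b) => //.
    apply: leq_trans leNk; rewrite (bigD1 a) //= [ltnRHS](bigD1 a) //=.
    rewrite {1}/drop eqxx [#|N a|](cardsD1 b) bN add1n addSn ltnS.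
    rewrite leq_add2l; apply: leq_sum => c /andP[_ /negPf ca].
    by rewrite /drop ca.
  exists f; split=> // c cD; have := fN c cD; rewrite /drop.
  by case: eqP => // ->; rewrite inE => /andP[].
have N1 a : a \in D -> exists b, N a = [set b].
  move=> aD; apply/cards1P; rewrite eqn_leq; apply/andP; split.
    by have := le1 a; rewrite aD /= -leqNgt.
  by have := condN [set a]; rewrite big_set1 cards1 sub1set; apply.
have [a0 a0D] : exists a, a \in D by apply/card_gt0P.
have [b0 _] := N1 a0 a0D.
exists (fun a => odflt b0 [pick b in N a]).
have fP a : a \in D -> N a = [set odflt b0 [pick b in N a]].
  move=> aD; have [b ->] := N1 a aD.
  case: pickP => [c|/(_ b)]; last by rewrite inE eqxx.
  by rewrite inE => /eqP ->.
split=> [a c aD cD eqf|a aD]; last by rewrite {2}fP // set11.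
apply/eqP/negPn/negP => ac.
have := condN [set a; c]; rewrite cards2 ac bigcup_setU !big_set1.
rewrite (fP a) // (fP c) // -eqf setUid cards1.
by rewrite subUset !sub1set aD cD => /(_ isT).
Qed.

End Hall.

Section Tree.
Variables (U : finType) (T : sgraph U) (v : U).

(* The reverse of s lists a subtree, each vertex after the first being attached to a
   unique earlier one. *)
Fixpoint attached (s : seq U) : Prop :=
  match s with
  | [::] => True
  | u :: s' => u \notin s' /\ attached s' /\
     (s' = [::] \/ exists y, [/\ y \in s', T u y & forall z, z \in s' -> T u z -> z = y])
  end.

(** The paths must stay inside [s]: a vertex outside [s] with two neighbours in [s] then closes a
    cycle. *)
Let conn (s : seq U) := forall a b, a \in s -> b \in s ->
  connect [rel x y | [&& T x y, x \in s & y \in s]] a b.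

Lemma tree_sequence k : tree T -> 0 < k <= #|U| ->
  exists s, [/\ size s = k, attached s, conn s & last v s = v].
Proof.
move=> [[_ Tconn] Tac]; elim: k => // -[_ _|k IH /andP[_ ltkU]].
  exists [:: v]; split=> //=; first by split=> //; split=> //; left.
  by move=> a b; rewrite !inE => /eqP-> /eqP->; exact: connect0.
have [|s [szs atts conns lasts]] := IH; first exact: ltnW.
have uniqs : uniq s.
  elim: (s) atts => //= u s' IHs [us [/IHs -> _]]; by rewrite us.
have vs : v \in s by move: szs; rewrite -lasts; case: (s) => //= u s' _; exact: mem_last.
have [u us] : exists u, u \notin s.
  apply/existsP; rewrite -negb_forall; apply/negP => /forallP alls.
  have : size s < #|U| by rewrite szs.
  rewrite ltnNge -(card_uniqP uniqs) => /negP[].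
  by apply: subset_leq_card; apply/subsetP.
(* The first edge by which a path from [v] to [u] leaves [s]. *)
have [y0 y0s [u0 [u0s Tyu]]] : exists2 y, y \in s & exists u, u \notin s /\ T y u.
  have /connectP[p] := Tconn v u; elim: p v vs => [|b p IHp] a a_s /=.
    by move=> _ eua; rewrite eua a_s in us.
  case/andP=> Tab pthb ulast; have [bs|bs] := boolP (b \in s).
    exact: IHp bs pthb ulast.
  by exists a => //; exists b.
have sz2 : s != [::] by case: (s) vs.
have uniqy z : z \in s -> T u0 z -> z = y0.
  move=> zs Tuz; apply/eqP/negPn/negP => zy.
  have /connectP[p pth zlast] := conns y0 z y0s zs.
  (* A cycle in [acyclic] has no repeated vertex, so the path is shortened first; [z != y0] gives
     the third vertex. *)
  case/shortenP: pth zlast => p' pth' unp' _ zlast.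
  have ps : all (mem s) (y0 :: p').
    rewrite /= y0s; elim: p' (y0) pth' {unp' zlast} => //= c p' IHp a.
    by case/andP=> /and3P[_ _ ->] /IHp.
  apply: (Tac (u0 :: y0 :: p')).
    by case: p' zlast zy {unp' pth' ps} => //= zlast; rewrite zlast eqxx.
  apply/andP; split; last first.
    rewrite cons_uniq unp' andbT; apply: contra u0s => /(allP ps); exact.
  rewrite /cycle rcons_cons /= adj_sym Tyu rcons_path -zlast [T z u0]adj_sym Tuz andbT.
  by apply: sub_path pth' => a b /and3P[].
exists (u0 :: s); split=> //=; first by rewrite szs.
- split=> //; split=> //; right; exists y0; split=> //.
  by rewrite adj_sym.
- have sub a b : a \in s -> b \in s ->
      connect [rel x y | [&& T x y, x \in u0 :: s & y \in u0 :: s]] a b.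
    move=> a_s bs; apply: connect_sub (conns a b a_s bs) => c d /and3P[Tcd cs ds].
    by apply: connect1; rewrite /= Tcd !inE cs ds !orbT.
  have uy : connect [rel x y | [&& T x y, x \in u0 :: s & y \in u0 :: s]] u0 y0.
    by apply: connect1; rewrite /= adj_sym Tyu !inE eqxx y0s orbT.
  have yu : connect [rel x y | [&& T x y, x \in u0 :: s & y \in u0 :: s]] y0 u0.
    by apply: connect1; rewrite /= Tyu !inE eqxx y0s orbT.
  move=> a b; rewrite !inE => /orP[/eqP->|a_s] /orP[/eqP->|bs].
  + exact: connect0.
  + exact: connect_trans uy (sub _ _ _ _).
  + exact: connect_trans (sub _ _ _ _) yu.
  + exact: sub.
- by case: (s) sz2 lasts.
Qed.

(** The bound on the index excludes only the last entry, the root. Vertices attached earlier have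
    larger index. *)
Lemma attached_index s u : attached s -> u \in s -> index u s < (size s).-1 ->
  exists y, [/\ y \in s, T u y, index u s < index y s
    & forall z, z \in s -> index u s < index z s -> T u z -> z = y].
Proof.
elim: s => // w s IHs /= [ws [atts uniqy]]; rewrite inE eq_sym.
have [<- _ sz0|wu /= us] := eqVneq w u.
  case: uniqy => [s0|[y [ys Twy yP]]]; first by rewrite s0 in sz0.
  have wz z : z \in s -> (w == z) = false by move=> zs; apply: contraNF ws => /eqP->.
  exists y; split; rewrite ?inE ?ys ?orbT ?wz // => z.
  rewrite inE; case: eqVneq => [->|_ /=] //.
  by move=> zs _; apply: yP.
rewrite -ltn_predRL => /(IHs atts us)[y [ys Tuy lt_uy yP]].
have wy : w != y by apply: contraNneq ws => ->.
exists y; split; rewrite ?inE ?ys ?orbT ?(negPf wy) // => z.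
rewrite inE eq_sym; case: eqVneq => [//|_ /= zs]; exact: yP.
Qed.

Lemma tree_order : tree T -> exists (rank : U -> nat) (par : U -> U),
  [/\ injective rank, forall u, rank u < #|U|, rank v = 0,
      forall u, u != v -> T u (par u) /\ rank (par u) < rank u
    & forall y z, T y z -> rank y < rank z -> y = par z].
Proof.
move=> treeT; have U0 : 0 < #|U| by case: treeT => -[].
have [|s [szs atts _ lasts]] := @tree_sequence #|U| treeT.
  by rewrite leqnn andbT.
have uniqs : uniq s.
  elim: (s) atts => //= u s' IHs [us [/IHs -> _]]; by rewrite us.
have ins u : u \in s.
  have /uniq_min_size : {subset s <= enum U} by move=> w _; rewrite mem_enum.
  by rewrite -cardE szs => /(_ uniqs (leqnn _))[_ ->]; rewrite ?mem_enum.
have lt_index u : index u s < #|U| by rewrite -szs index_mem.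
have index_v : index v s = #|U|.-1.
  by rewrite -szs -{1}lasts; case: (s) uniqs (ins v) => //= w s' ? _; exact: index_last.
(* The sequence lists the newest vertex first, so the index is reversed to give the root rank 0. *)
pose rank u := #|U|.-1 - index u s.
have rank_lt y z : (rank y < rank z) = (index z s < index y s).
  by rewrite /rank; have := lt_index y; have := lt_index z; lia.
have nbr u : u != v -> exists y, [/\ T u y, rank y < rank u
    & forall z, rank z < rank u -> T u z -> z = y].
  move=> uv; have [|y [_ Tuy lt_uy yP]] := attached_index atts (ins u).
    rewrite szs ltn_neqAle -index_v; apply/andP; split.
      by apply: contraNneq uv => /index_inj ->.
    by have := lt_index u; rewrite index_v; lia.
  exists y; rewrite rank_lt; split=> // z; rewrite rank_lt => ?; exact: yP.
(* The default is taken only at [v], which has no neighbour of smaller rank. *)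
pose par u := odflt u [pick y | T u y && (rank y < rank u)].
have parP u : u != v -> [/\ T u (par u), rank (par u) < rank u
    & forall z, rank z < rank u -> T u z -> z = par u].
  move=> /nbr[y [Tuy ltyu yP]]; rewrite /par.
  case: pickP => [w /= /andP[Tuw ltw]|/(_ y)]; last by rewrite Tuy ltyu.
  by rewrite (yP w).
have rank_v : rank v = 0 by rewrite /rank index_v subnn.
exists rank, par; split=> //.
- move=> y z; rewrite /rank; have := lt_index y; have := lt_index z => ltz lty eqr.
  by rewrite -(nth_index v (ins y)) -(nth_index v (ins z)); congr nth; lia.
- by move=> u; rewrite /rank; lia.
- by move=> u /parP[].
- move=> y z Tyz ltyz; have [zv|/parP[_ _]] := eqVneq z v.
    by move: ltyz; rewrite zv rank_v.
  by apply; rewrite // adj_sym.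
Qed.
End Tree.

Import Order.TTheory GRing.Theory Num.Theory.
Local Open Scope ring_scope.

(** * Random sets with independent elements *)

Section Expectation.
Variables (R : realType) (I : finType).
Implicit Types (w : I -> R) (h : {set I} -> R) (F : {set I}).

(** The probability depends on the element, so that sets which are not edges of [G] can get
    probability 0. *)
Definition weight w F : R := \prod_i (if i \in F then w i else 1 - w i).

Definition expect w h : R := \sum_F weight w F * h F.

Lemma weight_ge0 w F : (forall i, 0 <= w i <= 1) -> 0 <= weight w F.
Proof.
move=> w01; apply: prodr_ge0 => i _.
by case/andP: (w01 i) => w0 w1; case: ifP => // _; rewrite subr_ge0.
Qed.

Lemma expect_le w h1 h2 : (forall i, 0 <= w i <= 1) ->
  (forall F, h1 F <= h2 F) -> expect w h1 <= expect w h2.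
Proof.
move=> w01 h12; apply: ler_sum => F _.
by apply: ler_wpM2l => //; apply: weight_ge0.
Qed.

Lemma eq_expect w h1 h2 : h1 =1 h2 -> expect w h1 = expect w h2.
Proof. by move=> h12; apply: eq_bigr => F _; rewrite h12. Qed.

Lemma expectD w h1 h2 :
  expect w (fun F => h1 F + h2 F) = expect w h1 + expect w h2.
Proof. by rewrite -big_split; apply: eq_bigr => F _; rewrite mulrDr. Qed.

Lemma expectZ w c h : expect w (fun F => c * h F) = c * expect w h.
Proof. by rewrite mulr_sumr; apply: eq_bigr => F _; rewrite mulrCA. Qed.

Lemma expect_sum w (J : Type) (r : seq J) (P : pred J) (h : J -> {set I} -> R) :
  expect w (fun F => \sum_(j <- r | P j) h j F)
  = \sum_(j <- r | P j) expect w (h j).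
Proof.
by rewrite exchange_big; apply: eq_bigr => F _; rewrite mulr_sumr.
Qed.

(** Independence: distributing the product of two-term sums gives one term for each set [F]. *)
Lemma expect_prod w (phi : I -> bool -> R) :
  expect w (fun F => \prod_i phi i (i \in F))
  = \prod_i (w i * phi i true + (1 - w i) * phi i false).
Proof.
rewrite bigA_distr; apply: eq_bigr => F _.
by rewrite -big_split; apply: eq_bigr => i _; case: (i \in F).
Qed.

Lemma expect_cst w c : expect w (fun=> c) = c.
Proof.
suff e1 : expect w (fun=> 1) = 1.
  by rewrite -[RHS]mulr1 -e1 -expectZ; apply: eq_expect => F; rewrite mulr1.
have prod1 : 1 = \prod_(i : I) 1 :> R by rewrite big1.
under eq_expect => F do rewrite prod1.
rewrite (expect_prod w (fun _ _ => 1)) big1 // => i _.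
by rewrite !mulr1 addrC subrK.
Qed.

Lemma expect_ge0 w h : (forall i, 0 <= w i <= 1) ->
  (forall F, 0 <= h F) -> 0 <= expect w h.
Proof.
by move=> w01 h0; rewrite -(expect_cst w 0); apply: expect_le.
Qed.

(* With [g i b1 b2 = b1 || b2] this is two-round exposure; with
   [g i b1 b2 = if i \in D then b1 else b2] it says that the parts of the random
   set inside and outside D are independent. *)
Lemma expect_mix (g : I -> bool -> bool -> bool) w w1 w2 h :
  (forall i, w i = w1 i * (w2 i * (g i true true)%:R
                           + (1 - w2 i) * (g i true false)%:R)
             + (1 - w1 i) * (w2 i * (g i false true)%:R
                           + (1 - w2 i) * (g i false false)%:R)) ->
  expect w h = expect w1 (fun F1 => expect w2 (fun F2 =>
    h [set i | g i (i \in F1) (i \in F2)])).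
Proof.
move=> gw.
(* By linearity it suffices to compare the probabilities of single outcomes. *)
have hE (E : {set I}) : h E = \sum_F (E == F)%:R * h F.
  rewrite (bigD1 E) //= eqxx mul1r big1 ?addr0 // => F.
  by rewrite eq_sym => /negPf ->; rewrite mul0r.
have -> : expect w1 (fun F1 => expect w2 (fun F2 =>
    h [set i | g i (i \in F1) (i \in F2)])) =
  \sum_F expect w1 (fun F1 => expect w2 (fun F2 =>
    ([set i | g i (i \in F1) (i \in F2)] == F)%:R)) * h F.
  under eq_bigr => F _ do rewrite mulrC -expectZ.
  rewrite -expect_sum; apply: eq_expect => F1.
  under [RHS]eq_bigr => F _ do rewrite -expectZ.
  rewrite -expect_sum; apply: eq_expect => F2.
  by rewrite hE; apply: eq_bigr => F _; rewrite mulrC.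
apply: eq_bigr => F _; congr (_ * _).
(* Equality of sets is a product over coordinates, so [expect_prod] applies to [F2] and then to
   [F1]. *)
have eqE (F1 F2 : {set I}) : ([set i | g i (i \in F1) (i \in F2)] == F)%:R
    = \prod_i (g i (i \in F1) (i \in F2) == (i \in F))%:R :> R.
  have [<-|neq] := eqVneq.
    by rewrite big1 // => i _; rewrite inE eqxx.
  have /existsP[i gi] : [exists i, g i (i \in F1) (i \in F2) != (i \in F)].
    apply: contraNT neq; rewrite negb_exists => /forallP eqF.
    by apply/eqP/setP => i; rewrite inE; apply/eqP; rewrite -[_ == _]negbK.
  by rewrite (bigD1 i) //= (negPf gi) mul0r.
under eq_expect => F1.
  under eq_expect => F2 do rewrite eqE.
  rewrite (expect_prod w2 (fun i b => (g i (i \in F1) b == (i \in F))%:R)).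
  over.
rewrite (expect_prod w1 (fun i b => w2 i * (g i b true == (i \in F))%:R
   + (1 - w2 i) * (g i b false == (i \in F))%:R)).
apply: eq_bigr => i _; have := gw i.
by do 4![case: (g i _ _)]; case: (i \in F) => /= ->; ring.
Qed.

Lemma expect_avoid w (Q : {set I}) :
  expect w (fun F => [disjoint Q & F]%:R) = \prod_(i in Q) (1 - w i).
Proof.
have ind (F : {set I}) : [disjoint Q & F]%:R
    = \prod_i (~~ ((i \in Q) && (i \in F)))%:R :> R.
  have [dQF|/pred0Pn[i /= QFi]] := boolP [disjoint Q & F].
    rewrite big1 // => i _; have := @disjointFr _ _ _ i dQF.
    by case: (i \in Q) => //= ->.
  by rewrite (bigD1 i) //= QFi mul0r.
rewrite (eq_expect w ind).
rewrite (expect_prod w (fun i b => (~~ ((i \in Q) && b))%:R)).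
rewrite [RHS]big_mkcond; apply: eq_bigr => i _.
by case: (i \in Q) => /=; ring.
Qed.

(* Markov's inequality for [2 ^- #|Q :&: F|]. *)
Lemma expect_few w (Q : {set I}) (d : nat) : (forall i, 0 <= w i <= 1) ->
  expect w (fun F => (#|Q :&: F| < d)%:R)
  <= 2 ^+ d * \prod_(i in Q) (1 - w i / 2).
Proof.
move=> w01.
have -> : \prod_(i in Q) (1 - w i / 2)
    = expect w (fun F => 2^-1 ^+ #|Q :&: F|).
  have pow (F : {set I}) : 2^-1 ^+ #|Q :&: F|
      = \prod_i (if (i \in Q) && (i \in F) then 2^-1 else 1) :> R.
    by rewrite -prodr_const big_mkcond; apply: eq_bigr => i _; rewrite inE.
  rewrite (eq_expect w pow).
  rewrite (expect_prod w (fun i b => if (i \in Q) && b then 2^-1 else 1)).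
  rewrite big_mkcond; apply: eq_bigr => i _.
  by case: (i \in Q) => /=; field.
rewrite -expectZ; apply: expect_le => // F.
case: ltnP => /= [lt|_]; last by rewrite mulr_ge0 ?exprn_ge0 ?invr_ge0.
rewrite exprVn -[X in X <= _](@divff _ (2 ^+ #|Q :&: F|)) ?expf_neq0 ?pnatr_eq0 //.
by rewrite ler_pM2r ?invr_gt0 ?exprn_gt0 // ler_weXn2l ?ler1n // ltnW.
Qed.

End Expectation.

(** A set [F] that contains a non-edge has weight 0, which restricts the sum to subsets of
    [edges G]. *)
Lemma Gp_prob_expect (R : realType) (V : finType) (G : sgraph V) (p : R)
    (A : pred (sgraph V)) :
  Gp_prob G p A = expect (fun e => if e \in edges G then p else 0)
                           (fun F => (A (subgraph G F))%:R).
Proof.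
rewrite /Gp_prob big_mkcond; apply: eq_bigr => F _.
rewrite powersetE; have [sFE|/subsetPn[e eF eE]] /= := boolP (F \subset _).
  rewrite /kept_prob /weight [in LHS]big_mkcond mulrC.
  case: (A _); rewrite /= ?(mul1r, mul0r) //; apply: eq_bigr => e _.
  have := subsetP sFE e; case: (e \in F) => [->//|_].
  by case: (e \in edges G); rewrite ?subr0.
by rewrite /weight (bigD1 e) //= eF (negPf eE) !mul0r.
Qed.

(* q is chosen so that (1 - q) ^ 2 = 1 - p. *)
Lemma expect_union (R : realType) (I : finType) (p : R) (D : {set I}) h :
  p <= 1 ->
  let q := 1 - Num.sqrt (1 - p) in
  let w r i := if i \in D then r else 0 in
  expect (w p) h = expect (w q) (fun F1 => expect (w q) (fun F2 => h (F1 :|: F2))).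
Proof.
move=> p1 q w.
rewrite (@expect_mix _ _ (fun _ => orb) (w p) (w q) (w q)); last first.
  move=> i; rewrite /w /=; case: (i \in D); last by ring.
  rewrite !mulr1 mulr0 addr0.
  have := @sqr_sqrtr _ (1 - p); rewrite subr_ge0 => /(_ p1) sq.
  by rewrite /q; lra.
by apply: eq_expect => F1; apply: eq_expect => F2.
Qed.

(** Used with [D] the edges at one vertex: these are exposed first, and the others come from a fresh
    sample. *)
Lemma expect_resample (R : realType) (I : finType) (w : I -> R) (D : {set I}) h :
  expect w h
  = expect w (fun F1 => expect w (fun F2 => h (F1 :&: D :|: F2 :\: D))).
Proof.
rewrite (@expect_mix _ _ (fun i b1 b2 => if i \in D then b1 else b2) w w w).
  apply: eq_expect => F1; apply: eq_expect => F2; congr h.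
  by apply/setP => i; rewrite !inE; case: (i \in D); rewrite ?andbT ?andbF ?orbF.
by move=> i; case: (i \in D) => /=; ring.
Qed.

(** * The two rounds of the embedding *)

(** This evaluates the union bounds over all sets. *)
Lemma sum_pow_card (R : comNzRingType) (I : finType) (y : R) :
  \sum_(A : {set I}) y ^+ #|A| = (1 + y) ^+ #|I|.
Proof.
have -> : (1 + y) ^+ #|I| = \prod_(i : I) (y + 1).
  by rewrite prodr_const addrC cardT.
rewrite bigA_distr; apply: eq_bigr => A _.
by rewrite -prodr_const big_mkcond.
Qed.

Lemma subgraphE (V : finType) (G : sgraph V) F a b :
  subgraph G F a b = G a b && ([set a; b] \in F).
Proof. by []. Qed.

Lemma half_lt b z k m : (z + b = m -> b < m./2 -> z < k -> m./2 < k)%N.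
Proof. by have := odd_double_half m; lia. Qed.

Section Embedding.
Variables (R : realType) (U V : finType) (T : sgraph U) (G : sgraph V).
Variables (v : U) (x : V) (rank : U -> nat) (par : U -> U) (q : R).
Hypothesis card_UV : #|U| = #|V|.
Hypothesis rank_inj : injective rank.
Hypothesis rank_lt : forall u, (rank u < #|U|)%N.
Hypothesis rank_root : rank v = 0%N.
Hypothesis parP : forall u, u != v -> T u (par u) /\ (rank (par u) < rank u)%N.
Hypothesis par_uniq : forall y z, T y z -> (rank y < rank z)%N -> y = par z.
Hypothesis q01 : 0 <= q <= 1.

Let L := leaves T :\ v.
Let K := ~: L.
Let D := max_degree T.
Let w (e : {set V}) : R := if e \in edges G then q else 0.

Let w01 e : 0 <= w e <= 1.
Proof. by rewrite /w; case: ifP => // _; rewrite lexx ler01. Qed.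

Let root_K : v \in K.
Proof. by rewrite !inE eqxx. Qed.

(** A parent other than [v] is adjacent both to its child and to its own parent, which differ in
    rank, so it is not a leaf. *)
Let par_K u : u != v -> par u \in K.
Proof.
move=> uv; rewrite !inE; apply/negP => /andP[pv /cards1P[y nbr]].
have [Tup lt_up] := parP uv; have [Tpp lt_pp] := parP pv.
have : u \in [set z | T (par u) z] by rewrite inE adj_sym.
have : par (par u) \in [set z | T (par u) z] by rewrite inE.
rewrite nbr !inE => /eqP e1 /eqP e2.
by move: (ltn_trans lt_pp lt_up); rewrite e1 -e2 ltnn.
Qed.

Let children (X : {set U}) t : v \notin X ->
  (forall u, u \in X -> par u = t) -> (#|X| <= D)%N.
Proof.
move=> vX Xt; apply: (@leq_trans (degree T t)).
  apply: subset_leq_card; apply/subsetP => u uX; rewrite inE -(Xt u uX) adj_sym.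
  by case: (@parP u) => //; apply: contraNneq vX => <-.
by rewrite /D /max_degree (bigD1 t) //= leq_maxl.
Qed.

(** * First round: greedy embedding of the tree without [L] *)

Section Greedy.
Variable eps : R.
Hypothesis few_nbrs : forall (y : V) (Y : {set V}), (#|L| <= #|Y|)%N ->
  expect w (fun F => (#|[set z in Y | subgraph G F y z]| < D)%:R) <= eps.

(* The vertices that have an image once the children of all vertices of rank
   less than k have been placed. *)
Definition reached k := [set u | (u \notin L) && ((u == v) || (rank (par u) < k)%N)].

(** Only edges to vertices still to be placed are required, so the event involves no edge exposed
    earlier. The values of [f] outside [reached k] are irrelevant. *)
Definition extendable k (f : {ffun U -> V}) F :=
  [exists g : {ffun U -> V}, [&& dinjectiveb g (mem K),
    [forall u in reached k, g u == f u] &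
    [forall u in K :\: reached k, subgraph G F (g (par u)) (g u)]]].

Let reached_sub k : reached k \subset K.
Proof. by apply/subsetP => u; rewrite !inE => /andP[->]. Qed.

Let card_free k (f : {ffun U -> V}) : (#|L| <= #|~: f @: reached k|)%N.
Proof.
have eV : (#|f @: reached k| + #|~: f @: reached k| = #|U|)%N.
  by rewrite cardsC card_UV.
have eU : (#|L| + #|K| = #|U|)%N by rewrite cardsC.
rewrite -(leq_add2r #|K|) eU -eV addnC leq_add2l.
by apply: leq_trans (leq_imset_card _ _) _; apply: subset_leq_card.
Qed.

(** The edges at [f t] are read from [F1] and serve the children of [t]. All later edges avoid
    [f t], so they can be read from [F2]. *)
Let extendable_step k t (f : {ffun U -> V}) (F1 : {set {set V}}) :
  let D1 := [set e : {set V} | f t \in e] in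
  {in reached k &, injective f} -> rank t = k -> t \in reached k ->
  (D <= #|[set z in ~: f @: reached k | subgraph G F1 (f t) z]|)%N ->
  exists2 f' : {ffun U -> V}, {in reached k.+1 &, injective f'} &
    forall F2, extendable k.+1 f' F2 -> extendable k f (F1 :&: D1 :|: F2 :\: D1).
Proof.
move=> D1 injf rk tk; set N := [set z in _ | _] => leN.
pose C := reached k.+1 :\: reached k.
have vC : v \notin C by rewrite !inE eqxx.
have Cpar u : u \in C -> par u = t.
  rewrite !inE; case: (eqVneq u v) => /= [//|uv].
  case/andP=> + /andP[uL lt1]; rewrite uL /= => nlt.
  by apply: rank_inj; rewrite rk; lia.
have [h [injh hN]] : exists h : U -> V, {in C &, injective h} /\
    forall u, u \in C -> h u \in N.
  have [C0|C0] := posnP #|C|.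
    exists f; move/eqP: C0; rewrite cards_eq0 => /eqP->.
    by split=> u; rewrite inE.
  (* For a constant family, Hall's theorem yields an injection of [C] into [N], as #|C| <= D <=
     #|N|. *)
  apply: (hall_marriage C0 (N := fun=> N)) => X XC.
  have [->|[u uX]] := set_0Vmem X; first by rewrite cards0.
  apply: leq_trans (subset_leq_card XC) _.
  apply: leq_trans (children vC Cpar) _; apply: leq_trans leN _.
  exact: subset_leq_card (bigcup_sup u uX).
exists [ffun u => if u \in C then h u else f u].
  have fN u y : u \in reached k -> y \in C -> f u != h y.
    move=> uk /hN; rewrite !inE => /andP[+ _]; apply: contraNneq => <-.
    exact: imset_f.
  have notC u : u \in reached k.+1 -> (u \in C) = (u \notin reached k).
    by move=> uk; rewrite inE uk andbT.
  move=> u y uk yk; rewrite !ffunE.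
  case: ifP => uC; case: ifP => yC eqf; first exact: injh.
  - move/negbT: yC; rewrite notC // negbK => /fN/(_ uC).
    by rewrite eqf eqxx.
  - move/negbT: uC; rewrite notC // negbK => /fN/(_ yC).
    by rewrite eqf eqxx.
  - move: uC yC; rewrite !notC // => /negbFE uk' /negbFE yk'; exact: injf.
move=> F2 /existsP[g /and3P[injg /forall_inP gf' /forall_inP gF]].
have sub_k u : u \in reached k -> u \in reached k.+1.
  by rewrite !inE => /andP[-> /orP[->//|lt]]; rewrite (leq_trans lt) ?orbT.
have gf u : u \in reached k -> g u = f u.
  by move=> uk; rewrite (eqP (gf' u (sub_k u uk))) ffunE in_setD uk.
apply/existsP; exists g; rewrite injg; apply/and3P; split=> //.
  by apply/forall_inP => u /gf ->.
apply/forall_inP => u; rewrite inE => /andP[uk uK].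
have [uC|uC] := boolP (u \in C).
  have uk1 : u \in reached k.+1 by move: uC; rewrite inE => /andP[].
  rewrite (Cpar u uC) (gf t tk) (eqP (gf' u uk1)) ffunE uC.
  have := hN u uC; rewrite inE => /andP[_ /andP[Gth Fth]].
  by rewrite subgraphE Gth !inE Fth eqxx.
have uk1 : u \notin reached k.+1 by move: uC; rewrite inE uk.
have := gF u; rewrite inE uk1 uK => /(_ isT)/andP[Gpu eF].
(* Neither endpoint is [f t]: by injectivity of [g], either [par u = t] and [u] was just placed, or
   [u = t] and [u] was placed before. *)
rewrite subgraphE Gpu !inE eF andbT negb_or /=; apply/orP; right.
have uv : u != v by apply: contraNneq uk => ->; rewrite !inE !eqxx.
have tK := subsetP (reached_sub k) t tk.
rewrite -(gf t tk); apply/andP; split.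
  apply: contraNneq uk1 => /(dinjectiveP _ _ injg t (par u) tK (par_K uv)) etp.
  by move: uK; rewrite !inE => ->; rewrite -etp rk ltnSn orbT.
by apply: contraNneq uk => /(dinjectiveP _ _ injg t u tK uK) <-.
Qed.

(** Here [j] counts the ranks still to be processed; each costs at most [eps], the probability of
    having too few free neighbours. *)
Lemma greedy_extendable j : (j <= #|U|)%N -> forall f : {ffun U -> V},
  {in reached (#|U| - j) &, injective f} ->
  1 - j%:R * eps <= expect w (fun F => (extendable (#|U| - j) f F)%:R).
Proof.
have eps0 : 0 <= eps.
  apply: le_trans (few_nbrs x (Y := setT) _); last by rewrite cardsT -card_UV max_card.
  by apply: expect_ge0.
elim: j => [_ f injf|j IH ltj f injf].
  rewrite mul0r subr0 subn0 -[X in X <= _](expect_cst w); apply: expect_le => // F.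
  rewrite ler1n lt0b; apply/existsP; exists f.
  have Kn : K :\: reached #|U| = set0.
    apply/setP => u; rewrite !inE rank_lt orbT andbT.
    by rewrite negbK andbN.
  rewrite Kn; apply/and3P; split; last 2 first.
  - by apply/forall_inP.
  - by apply/forall_inP => u; rewrite inE.
  apply/dinjectiveP => y z yK zK; apply: injf; rewrite subn0;
  by rewrite !inE rank_lt orbT andbT; move: yK zK; rewrite !inE.
have [k [kj kj1]] : exists k, (#|U| - j.+1 = k /\ #|U| - j = k.+1)%N.
  by exists (#|U| - j.+1)%N; lia.
rewrite kj in injf *; rewrite kj1 in IH; have {}IH := IH (ltnW ltj).
have step : 1 - j.+1%:R * eps <= 1 - j%:R * eps.
  by rewrite lerB // ler_wpM2r // ler_nat.
(* If the vertex of rank [k] has no child to place, nothing is exposed. *)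
have [C0|[c]] := set_0Vmem (reached k.+1 :\: reached k).
  have eqk : reached k.+1 = reached k.
    apply/eqP; rewrite eqEsubset -setD_eq0 C0 eqxx /=.
    apply/subsetP => u; rewrite !inE => /andP[-> /orP[->//|lt]].
    by rewrite (leq_trans lt) ?orbT.
  apply: le_trans step _; have := IH f; rewrite eqk => /(_ injf).
  by rewrite /extendable eqk.
rewrite !inE => /andP[nck /andP[cL]]; rewrite cL /= negb_or in nck.
case/andP: nck => cv nlt; rewrite (negPf cv) /= => lt_ck.
have rk : rank (par c) = k by lia.
set t := par c in rk.
have tk : t \in reached k.
  have := par_K cv; rewrite -/t !inE => ->.
  by case: (eqVneq t v) => //= /parP[_]; rewrite rk.
rewrite (expect_resample w [set e : {set V} | f t \in e]).
pose few F := (#|[set z in ~: f @: reached k | subgraph G F (f t) z]| < D)%N.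
have few_eps : expect w (fun F => (few F)%:R) <= eps by apply/few_nbrs/card_free.
apply: (@le_trans _ _ (expect w (fun F => (1 - j%:R * eps) + (-1) * (few F)%:R))).
  rewrite expectD expectZ expect_cst -natr1; lra.
apply: expect_le => // F1.
have [_|] /= := boolP (few F1).
  (* On the bad event the subtracted indicator makes the left side nonpositive. *)
  apply: (@le_trans _ _ 0); last by apply: expect_ge0.
  have : 0 <= j%:R * eps by exact: mulr_ge0.
  lra.
rewrite mulr0 addr0 -leqNgt => good.
have [f' injf' f'P] := extendable_step injf rk tk good.
apply: le_trans (IH f' injf') _; apply: expect_le => // F2.
by rewrite ler_nat; have := f'P F2; case: (extendable _ _ _) => // ->.
Qed.

End Greedy.
Section Leaves.
Variables (d : nat) (y : R) (f : {ffun U -> V}).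
Hypothesis few_missing : forall a, (#|[set b | ~~ G a b]| <= d)%N.
Hypothesis y01 : 0 <= y <= 1.
Let m := #|L|.
Hypothesis few_parents : (1 - q) ^+ (m./2 - d) <= y ^+ D.+1.
Hypothesis many_parents : (1 - q) ^+ (m./2 %/ D - d) <= y ^+ 2.
Hypothesis injf : {in K &, injective f}.

Definition completable F := [exists g : {ffun U -> V}, [&& injectiveb g,
  [forall u in K, g u == f u] & [forall u in L, subgraph G F (f (par u)) (g u)]]].

Let W := par @: L.
Let B := ~: f @: K.

Definition no_edges (S : {set U}) (Y : {set V}) F :=
  [forall s in S, forall b in Y, ~~ subgraph G F (f s) b].

Let card_B : #|B| = m.
Proof.
have eV : (#|f @: K| + #|B| = #|U|)%N by rewrite cardsC card_UV.
have eU : (#|L| + #|K| = #|U|)%N by rewrite cardsC.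
by move: eV; rewrite card_in_imset // -eU addnC => /addIn.
Qed.

Let sub_WK : W \subset K.
Proof.
by apply/subsetP => _ /imsetP[u uL ->]; apply: par_K; move: uL; rewrite !inE => /andP[].
Qed.

Lemma hall_violation F : ~~ completable F -> exists (S : {set U}) (Z : {set V}),
  [/\ S \subset W, Z \subset B, (#|Z| < D * #|S|)%N,
      (#|W :\: S| < #|B :\: Z|)%N & no_edges S (B :\: Z) F].
Proof.
move=> ncomp; pose N u := [set b in B | subgraph G F (f (par u)) b].
have [X XL ltX] : exists2 X : {set U}, X \subset L & (#|\bigcup_(u in X) N u| < #|X|)%N.
  have [/existsP[X /andP[XL ltX]]|/existsPn noX] := boolP
      [exists X : {set U}, (X \subset L) && (#|\bigcup_(u in X) N u| < #|X|)%N].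
    by exists X.
  case/negP: ncomp.
  have [h [injh hN]] : exists h : U -> V, {in L &, injective h} /\
      forall u, u \in L -> h u \in N u.
    have [L0|L0] := posnP #|L|.
      exists f; move/eqP: L0; rewrite cards_eq0 => /eqP->.
      by split=> u; rewrite inE.
    apply: hall_marriage => // X XL.
    by have := noX X; rewrite XL -leqNgt.
  have hB u z : u \in L -> z \in K -> h u != f z.
    move=> uL zK; have := hN u uL; rewrite !inE => /andP[+ _].
    by apply: contraNneq => ->; apply: imset_f.
  apply/existsP; exists [ffun u => if u \in L then h u else f u].
  apply/and3P; split.
  - apply/injectiveP => u z; rewrite !ffunE.
    case: ifPn => uL; case: ifPn => zL eqf.
    + exact: injh.
    + by have := hB u z uL; rewrite inE eqf eqxx => /(_ zL).
    + by have := hB z u zL; rewrite inE eqf eqxx => /(_ uL).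
    + by apply: injf; rewrite // inE.
  - by apply/forall_inP => u; rewrite inE ffunE => /negPf->.
  - apply/forall_inP => u uL; rewrite ffunE uL.
    by have := hN u uL; rewrite inE => /andP[].
have vX : v \notin X by apply: contraTN root_K => /(subsetP XL); rewrite !inE => ->.
(* A parent has at most [D] children, so #|Z| < #|X| <= D * #|S|. A parent outside [S] has its
   leaves outside [X], so #|W - S| <= #|L - X| < m - #|Z|. *)
exists (par @: X), (\bigcup_(u in X) N u).
have ZB : \bigcup_(u in X) N u \subset B.
  by apply/bigcupsP => u _; apply/subsetP => b; rewrite inE => /andP[].
split=> //; first exact: imsetS.
- apply: leq_trans ltX _; rewrite -sum1_card (partition_big_imset par) /=.
  rewrite mulnC -sum_nat_const; apply: leq_sum => s _.
  rewrite sum1_card -cardsE; apply: (@children _ s).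
    by rewrite inE; apply: contra vX => /andP[].
  by move=> u; rewrite inE => /andP[_ /eqP].
- apply: (@leq_ltn_trans #|L :\: X|).
    apply: leq_trans (leq_imset_card par _); apply: subset_leq_card.
    apply/subsetP => _ /setDP[/imsetP[u uL ->] nX]; apply: imset_f.
    by rewrite inE uL andbT; apply: contra nX; apply: imset_f.
  rewrite (cardsD L X) (cardsD B) (setIidPr XL) (setIidPr ZB) card_B -/m.
  by apply: ltn_sub2l => //; apply: leq_trans ltX _; exact: subset_leq_card.
- apply/forall_inP => _ /imsetP[u uX ->]; apply/forall_inP => b /setDP[bB].
  by apply: contra => uFb; apply/bigcupP; exists u; rewrite // inE bB.
Qed.

(** All edges of [G] between [f @: S] and [Y] must be missing. They can be counted from either side,
    each vertex losing at most [d] partners. *)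
Lemma no_edges_expect (S : {set U}) (Y : {set V}) k : S \subset K -> Y \subset B ->
  (k <= #|S| * (#|Y| - d))%N || (k <= #|Y| * (#|S| - d))%N ->
  expect w (fun F => (no_edges S Y F)%:R) <= (1 - q) ^+ k.
Proof.
move=> SK YB lek.
pose P := [set sb : U * V | [&& sb.1 \in S, sb.2 \in Y & G (f sb.1) sb.2]].
pose e (sb : U * V) := [set f sb.1; sb.2].
have injS : {in S &, injective f} by move=> s t /(subsetP SK) ? /(subsetP SK) ?; apply: injf.
have fY s b : s \in S -> b \in Y -> f s != b.
  move=> /(subsetP SK) sK /(subsetP YB); rewrite inE.
  by apply: contraNneq => <-; apply: imset_f.
(* An unordered edge determines its pair because [f @: S] and [Y] are disjoint. *)
have inje : {in P &, injective e}.
  move=> [s b] [s' b']; rewrite !inE /= => /and3P[sS bY _] /and3P[s'S b'Y _] /setP eqe.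
  have := eqe (f s); rewrite !inE eqxx /= (negPf (fY _ _ sS b'Y)) orbF => /esym/eqP/(injS _ _ sS s'S) ess.
  have := eqe b; rewrite !inE eqxx orbT /= eq_sym (negPf (fY _ _ s'S bY)) => /esym/eqP ->.
  by rewrite ess.
have card_S : (#|S| * (#|Y| - d) <= #|P|)%N.
  rewrite -sum_nat_const -[leqRHS]sum1_card.
  rewrite (partition_big fst (mem S)) /=; last by move=> sb; rewrite inE => /and3P[].
  apply: leq_sum => s sS; rewrite sum1_card.
  rewrite leq_subLR; apply: (@leq_trans (#|[set b | ~~ G (f s) b]| + #|Y :&: [set b | G (f s) b]|)).
    rewrite -[leqLHS](cardsID [set b | G (f s) b]) addnC leq_add2r.
    by apply: subset_leq_card; apply/subsetP => b; rewrite !inE => /andP[].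
  apply: leq_add (few_missing _) _.
  rewrite -(@card_imset _ _ (pair s)); last by move=> b b' [].
  apply: subset_leq_card; apply/subsetP => _ /imsetP[b + ->].
  rewrite !inE => /andP[bY Gsb]; apply/andP; split; [rewrite inE /= sS bY|]; done.
have card_Y : (#|Y| * (#|S| - d) <= #|P|)%N.
  rewrite -sum_nat_const -[leqRHS]sum1_card.
  rewrite (partition_big snd (mem Y)) /=; last by move=> sb; rewrite inE => /and3P[].
  apply: leq_sum => b bY; rewrite sum1_card.
  rewrite leq_subLR; apply: (@leq_trans (#|[set a | ~~ G b a]| + #|S :&: [set s | G (f s) b]|)).
    rewrite -[leqLHS](cardsID [set s | G (f s) b]) addnC leq_add2r.
    rewrite -(card_in_imset (f := f)).
      apply: subset_leq_card; apply/subsetP => _ /imsetP[s + ->].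
      by rewrite !inE adj_sym => /andP[].
    by move=> s t /setDP[sS _] /setDP[tS _]; apply: injS.
  apply: leq_add (few_missing _) _.
  rewrite -(@card_imset _ _ (fun s => (s, b))); last by move=> s s' [].
  apply: subset_leq_card; apply/subsetP => _ /imsetP[s + ->].
  rewrite !inE => /andP[sS Gsb]; apply/andP; split; [rewrite inE /= sS bY|]; done.
have {lek}leP : (k <= #|e @: P|)%N.
  rewrite card_in_imset //.
  by case/orP: lek => /leq_trans; apply.
apply: (@le_trans _ _ (expect w (fun F => [disjoint e @: P & F]%:R))).
  apply: expect_le => // F; rewrite ler_nat.
  case: (boolP (no_edges _ _ _)) => // /forall_inP noe; rewrite lt0b disjoint_subset.
  apply/subsetP => _ /imsetP[[s b] /[!inE] /and3P[/= sS bY Gsb] ->].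
  have /forall_inP/(_ b bY) := noe s sS.
  by rewrite subgraphE Gsb.
rewrite expect_avoid (eq_bigr (fun=> 1 - q)).
  case/andP: q01 => q0 q1.
  rewrite prodr_const ler_wiXn2l ?subr_ge0 //; lra.
move=> _ /imsetP[[s b] /[!inE] /and3P[/= sS bY Gsb] ->].
rewrite /w ifT //; apply/imsetP; exists (f s, b) => //.
by rewrite inE.
Qed.

Lemma completable_expect :
  1 - 2 * (((1 + y) ^+ #|U| - 1) * (1 + y) ^+ #|U|)
  <= expect w (fun F => (completable F)%:R).
Proof.
case/andP: q01 => q0 q1; case/andP: y01 => y0 y1.
have q'0 : 0 <= 1 - q by rewrite subr_ge0.
pose bad1 (S : {set U}) (Z : {set V}) F := [&& S \subset K, Z \subset B,
  (#|Z| <= D * #|S|)%N, (m./2 <= #|B :\: Z|)%N & no_edges S (B :\: Z) F].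
pose bad2 (Y : {set V}) (S : {set U}) F := [&& Y \subset B, (#|S| <= #|Y|)%N,
  (m./2 %/ D <= #|W :\: S|)%N & no_edges (W :\: S) Y F].
have bad1E S Z : expect w (fun F => (bad1 S Z F)%:R) <= y ^+ #|S| * y ^+ #|Z|.
  have [/and4P[SK ZB leZ leB]|nbad] := boolP [&& S \subset K, Z \subset B,
     (#|Z| <= D * #|S|)%N & (m./2 <= #|B :\: Z|)%N]; last first.
    have -> : expect w (fun F => (bad1 S Z F)%:R) = 0.
      rewrite -(expect_cst w 0); apply: eq_expect => F.
      suff /negPf-> : ~~ bad1 S Z F by [].
      by apply: contra nbad => /and5P[h1 h2 h3 h4 _]; rewrite h1 h2 h3 h4.
    by rewrite mulr_ge0 ?exprn_ge0.
  apply: (@le_trans _ _ ((1 - q) ^+ (#|S| * (m./2 - d)))).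
    apply: le_trans (no_edges_expect (k := #|S| * (m./2 - d)) SK (subsetDl B Z) _).
      by apply: expect_le => // F; rewrite ler_nat /bad1; case: (no_edges _ _ _); rewrite ?andbF ?leq_b1.
    by rewrite leq_mul2l leq_sub2r ?orbT.
  (* The exponent D.+1 pays for both sets: #|S| + #|Z| <= D.+1 * #|S|. *)
  rewrite mulnC exprM; apply: (@le_trans _ _ ((y ^+ D.+1) ^+ #|S|)).
    by rewrite lerXn2r // nnegrE exprn_ge0.
  by rewrite -exprM -exprD ler_wiXn2l // mulSn leq_add2l.
have bad2E Y S : expect w (fun F => (bad2 Y S F)%:R) <= y ^+ #|Y| * y ^+ #|S|.
  have [/and3P[YB leS leW]|nbad] := boolP [&& Y \subset B, (#|S| <= #|Y|)%N &
     (m./2 %/ D <= #|W :\: S|)%N]; last first.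
    have -> : expect w (fun F => (bad2 Y S F)%:R) = 0.
      rewrite -(expect_cst w 0); apply: eq_expect => F.
      suff /negPf-> : ~~ bad2 Y S F by [].
      by apply: contra nbad => /and4P[h1 h2 h3 _]; rewrite h1 h2 h3.
    by rewrite mulr_ge0 ?exprn_ge0.
  apply: (@le_trans _ _ ((1 - q) ^+ (#|Y| * (m./2 %/ D - d)))).
    apply: le_trans (no_edges_expect (S := W :\: S) (k := #|Y| * (m./2 %/ D - d)) _ YB _).
    - by apply: expect_le => // F; rewrite ler_nat /bad2; case: (no_edges _ _ _); rewrite ?andbF ?leq_b1.
    - exact: subset_trans (subsetDl _ _) sub_WK.
    - by apply/orP; right; rewrite leq_mul2l leq_sub2r ?orbT.
  (* Here #|S| <= #|Y|, so the exponent 2 is enough. *)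
  rewrite mulnC exprM; apply: (@le_trans _ _ ((y ^+ 2) ^+ #|Y|)).
    by rewrite lerXn2r // nnegrE exprn_ge0.
  by rewrite -exprM -exprD ler_wiXn2l // mul2n -addnn leq_add2l.
have sumE (I J : finType) (bad : {set I} -> {set J} -> {set {set V}} -> bool) :
    #|I| = #|U| -> #|J| = #|U| ->
    (forall A C, expect w (fun F => (bad A C F)%:R) <= y ^+ #|A| * y ^+ #|C|) ->
    expect w (fun F => \sum_(A | A != set0) \sum_C (bad A C F)%:R)
    <= ((1 + y) ^+ #|U| - 1) * (1 + y) ^+ #|U|.
  move=> cI cJ badE; rewrite expect_sum.
  (* Leaving out the empty set removes the term 1, which is what makes the bound small. *)
  have -> : (1 + y) ^+ #|U| - 1 = \sum_(A : {set I} | A != set0) y ^+ #|A|.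
    rewrite -cI -sum_pow_card (bigD1 set0) //= cards0 expr0; ring.
  rewrite mulr_suml; apply: ler_sum => A _.
  rewrite expect_sum -cJ -sum_pow_card mulr_sumr.
  exact: ler_sum.
have e1 := sumE _ _ bad1 erefl (esym card_UV) bad1E.
have e2 := sumE _ _ bad2 (esym card_UV) erefl bad2E.
have sum0 (I J : finType) (bad : {set I} -> {set J} -> bool) :
    0 <= \sum_(A | A != set0) \sum_C (bad A C)%:R :> R.
  by apply: sumr_ge0 => A _; apply: sumr_ge0.
have sum1 (I J : finType) (bad : {set I} -> {set J} -> bool) A C :
    A != set0 -> bad A C -> 1 <= \sum_(A | A != set0) \sum_C (bad A C)%:R :> R.
  move=> A0 badAC; rewrite (bigD1 A) //= (bigD1 C) //= badAC -addrA lerDl.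
  by rewrite addr_ge0 // sumr_ge0 // => ? _; apply: sumr_ge0.
suff : expect w (fun=> 1) <= expect w (fun F => (completable F)%:R +
    (\sum_(S | S != set0) \sum_Z (bad1 S Z F)%:R +
     \sum_(Y | Y != set0) \sum_S (bad2 Y S F)%:R)).
  by rewrite !expectD expect_cst; lra.
apply: expect_le => // F.
have [_|/hall_violation[S [Z [SW ZB ltZ ltW noe]]]] := boolP (completable F).
  by rewrite lerDl addr_ge0.
rewrite add0r; have cardB : (#|Z| + #|B :\: Z| = m)%N.
  by rewrite -card_B -(cardsID Z B) (setIidPr ZB).
have [leB|ltB] := leqP m./2 #|B :\: Z|.
  apply: ler_wpDr => //; apply: (sum1 _ _ _ S Z).
    by apply: contraTneq ltZ => ->; rewrite cards0 muln0.
  by rewrite /bad1 (subset_trans SW sub_WK) ZB (ltnW ltZ) leB.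
apply: ler_wpDl => //; apply: (sum1 _ _ _ (B :\: Z) (W :\: S)).
  by rewrite -card_gt0; apply: leq_ltn_trans ltW.
have WS : W :\: (W :\: S) = S by rewrite setDDr setDv set0U; apply/setIidPr.
rewrite /bad2 WS subsetDl (ltnW ltW) noe andbT /=.
(* [Z] has at least half of [B] and #|Z| < D * #|S|, which bounds #|S| from below. *)
rewrite -ltnS ltn_divLR; last by case: (D) ltZ; rewrite ?mul0n.
by rewrite mulSn mulnC ltn_addl // (half_lt cardB).
Qed.

End Leaves.

(** The first round starts from the constant map [x], as [reached 0] is just [v]. For each
    successful [F1], the second round is applied to the resulting map. *)
Lemma embedding_expect (d : nat) (eps y : R) :
  (forall (a : V) (Y : {set V}), (#|L| <= #|Y|)%N ->
    expect w (fun F => (#|[set b in Y | subgraph G F a b]| < D)%:R) <= eps) ->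
  (forall a, (#|[set b | ~~ G a b]| <= d)%N) ->
  0 <= y <= 1 ->
  (1 - q) ^+ (#|L|./2 - d) <= y ^+ D.+1 ->
  (1 - q) ^+ (#|L|./2 %/ D - d) <= y ^+ 2 ->
  1 - #|U|%:R * eps - 2 * (((1 + y) ^+ #|U| - 1) * (1 + y) ^+ #|U|)
  <= expect w (fun F1 => expect w (fun F2 => [exists f : {ffun U -> V},
       embedding T (subgraph G (F1 :|: F2)) f && (f v == x)]%:R)).
Proof.
move=> few_nbrs few_missing y01 few_parents many_parents; set err := 2 * _.
have err0 : 0 <= err.
  case/andP: y01 => y0 _; have := exprn_ege1 #|U| (_ : 1 <= 1 + y).
  rewrite lerDl => /(_ y0) ge1.
  by rewrite /err !mulr_ge0 ?subr_ge0 // (le_trans ler01).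
have reached0 u : (u \in reached 0) = (u == v).
  by rewrite !inE orbF; case: eqVneq => //= _; rewrite andbF.
have := greedy_extendable few_nbrs (leqnn #|U|) (f := [ffun=> x]).
rewrite subnn => /(_ _)/(le_trans _) le_ext.
apply: (@le_trans _ _ (expect w (fun F => (extendable 0 [ffun=> x] F)%:R + (- err)))).
  rewrite expectD expect_cst lerD2r; apply: le_ext => //.
  by move=> u z; rewrite !reached0 => /eqP-> /eqP->.
apply: expect_le => // F1.
have [/existsP[g /and3P[/dinjectiveP injg /forall_inP gx /forall_inP gF]]|_] /=
    := boolP (extendable _ _ _); last first.
  by rewrite add0r (@le_trans _ _ 0) ?oppr_le0 // expect_ge0.
apply: le_trans (completable_expect few_missing y01 few_parents many_parents injg) _.
apply: expect_le => // F2; rewrite ler_nat.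
have [/existsP[f /and3P[injf /forall_inP fg /forall_inP fF]] /=|//] := boolP (completable _ _).
rewrite lt0b; apply/existsP; exists f.
rewrite (eqP (fg v root_K)) (eqP (gx v _)) ?reached0 // ffunE eqxx andbT.
rewrite /embedding injf andTb.
have edge z : z != v -> subgraph G (F1 :|: F2) (f (par z)) (f z).
  move=> zv; have fp := eqP (fg _ (par_K zv)); rewrite fp subgraphE inE.
  have [zL|zK] := boolP (z \in L).
    by have := fF z zL; rewrite subgraphE => /andP[-> ->]; rewrite orbT.
  have {}zK : z \in K by rewrite inE.
  rewrite (eqP (fg z zK)).
  by have := gF z; rewrite inE reached0 zv zK subgraphE => /(_ isT)/andP[-> ->].
have edge_lt y1 z : T y1 z -> (rank y1 < rank z)%N -> subgraph G (F1 :|: F2) (f y1) (f z).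
  move=> Tyz lt; rewrite (par_uniq Tyz lt); apply: edge.
  by apply: contraTneq lt => ->; rewrite rank_root.
apply/forallP => y1; apply/forallP => z; apply/implyP => Tyz.
case: (ltngtP (rank y1) (rank z)) => [lt|lt|/rank_inj eyz].
- exact: edge_lt.
- by rewrite adj_sym; apply: edge_lt; rewrite // adj_sym.
- by move: Tyz; rewrite eyz adj_irrefl.
Qed.

End Embedding.

(** * Numerical estimates *)

(** [expect_few] is applied to the edges of [G] from [a] to [Y], at least #|Y| - d in number. *)
Lemma few_nbrs_expect (R : realType) (V : finType) (G : sgraph V) (q : R)
    (a : V) (Y : {set V}) (d D : nat) :
  0 <= q <= 1 -> (#|[set b | ~~ G a b]| <= d)%N ->
  expect (fun e => if e \in edges G then q else 0)
    (fun F => (#|[set b in Y | subgraph G F a b]| < D)%:R)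
  <= 2 ^+ D * (1 - q / 2) ^+ (#|Y| - d).
Proof.
move=> q01 le_d; case/andP: (q01) => q0 q1.
pose Q := [set [set a; b] | b in [set b in Y | G a b]].
have edgeQ e : e \in Q -> e \in edges G.
  case/imsetP=> b; rewrite inE => /andP[_ Gab] ->.
  by apply/imsetP; exists (a, b) => //; rewrite inE.
have cardQ : (#|Y| - d <= #|Q|)%N.
  rewrite card_imset; last first.
    move=> b b' /setP eqe; have := eqe b; have := eqe b'.
    rewrite !inE !eqxx !orbT /= => /orP[/eqP->|/eqP->//].
    by rewrite orbb => /esym/eqP.
  rewrite leq_subLR -(cardsID [set b | G a b] Y) addnC leq_add //.
    apply: leq_trans le_d; apply: subset_leq_card.
    by apply/subsetP => b; rewrite !inE => /andP[].
  by apply: subset_leq_card; apply/subsetP => b; rewrite !inE.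
apply: (@le_trans _ _ (2 ^+ D * \prod_(e in Q) (1 - (if e \in edges G then q else 0) / 2))).
  have w01 e : 0 <= (if e \in edges G then q else 0) <= 1.
    by case: ifP => // _; rewrite lexx ler01.
  apply: le_trans (expect_few Q D w01); apply: expect_le => // F.
  rewrite ler_nat; case: ltnP => // ltN; rewrite lt0b.
  apply: leq_ltn_trans ltN.
  apply: leq_trans (leq_imset_card (fun b => [set a; b]) _).
  apply: subset_leq_card; apply/subsetP => e /setIP[/imsetP[b + ->] eF].
  by rewrite inE => /andP[bY Gab]; apply: imset_f; rewrite inE bY subgraphE Gab.
rewrite (eq_bigr (fun=> 1 - q / 2)) => [|e /edgeQ -> //].
rewrite prodr_const ler_wpM2l ?exprn_ge0 // ler_wiXn2l //; lra.
Qed.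

Lemma min_degree_le (V : finType) (G : sgraph V) a : (min_degree G <= degree G a)%N.
Proof.
rewrite /min_degree; have: a \in index_enum V by rewrite mem_index_enum.
elim: (index_enum V) => // b r IHr; rewrite inE big_cons geq_min => /orP[/eqP->|/IHr->].
  by rewrite leqnn.
by rewrite orbT.
Qed.

Lemma exprn_le_expR (R : realType) (a : R) (k : nat) (b : R) :
  0 <= a <= 1 -> b <= a * k%:R -> (1 - a) ^+ k <= expR (- b).
Proof.
move=> /andP[a0 a1] leb; apply: (@le_trans _ _ (expR (- a) ^+ k)).
  by rewrite lerXn2r ?nnegrE ?subr_ge0 ?expR_ge0 // expR_ge1Dx.
by rewrite -expRM_natr ler_expR mulNr lerN2.
Qed.

(** With z = n y, the power is at most expR z <= 1 / (1 - z) <= 1 + 2 z for 0 <= z <= 1/2. *)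
Lemma exprn_1D_le (R : realType) (y : R) (n : nat) :
  0 <= y -> n%:R * y <= 2^-1 -> (1 + y) ^+ n <= 1 + 2 * (n%:R * y).
Proof.
move=> y0 small; set z := n%:R * y in small *.
have z0 : 0 <= z by rewrite mulr_ge0.
apply: (@le_trans _ _ (expR z)).
  by rewrite expRM_natl lerXn2r ?nnegrE ?expR_ge0 ?addr_ge0 // expR_ge1Dx.
have := expR_ge1Dx (- z); rewrite expRN => le1.
have E0 := expR_gt0 z.
have le2 : (1 - z) * expR z <= 1 by rewrite -ler_pdivlMr // mul1r.
have zz : 0 <= z * (1 - 2 * z) by apply: mulr_ge0 => //; move: small; lra.
have z1 : 0 < 1 - z by move: small; lra.
rewrite -(ler_pM2l z1); apply: le_trans le2 _; lra.
Qed.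

Lemma natr_subr_le (R : realType) (a b : nat) : a%:R - b%:R <= (a - b)%:R :> R.
Proof. by rewrite lerBlDr -natrD ler_nat; lia. Qed.

Lemma natr_half_ge (R : realType) (m : nat) : m.+1%:R <= 2 * (m./2%:R) + 2 :> R.
Proof.
by rewrite -natrM -natrD ler_nat; have := odd_double_half m; case: (odd m); lia.
Qed.

Lemma natr_divn_ge (R : realType) (m D : nat) : (0 < D)%N ->
  m%:R <= (m %/ D)%:R * D%:R + D%:R :> R.
Proof.
move=> D0; rewrite -natrM -natrD ler_nat.
by rewrite {1}(divn_eq m D) leq_add2l ltnW // ltn_pmod.
Qed.

Section Numerics.
Variables (R : realType) (n D m d : nat) (p q : R).
Let l : R := ln n%:R.
Hypothesis l_ge : 1000 <= l.
Hypothesis D0 : (0 < D)%N.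
Hypothesis m_ge : n%:R / l ^+ 3 <= m.+1%:R.
Hypothesis d_le : d%:R <= n%:R / (D%:R * l ^+ 5).
Hypothesis p_le : p <= 1.
Hypothesis p_ge : D%:R * l ^+ 5 / n%:R <= p.
Hypothesis q_ge : p / 2 <= q.
Hypothesis q_le : q <= 1.

(** The common scale of the estimates: [m] is at least A - 1, while [D * d] is at most A / 10^6. *)
Let A := n%:R / l ^+ 3.

Let l0 : 0 < l. Proof. by apply: lt_le_trans l_ge; rewrite ltr0n. Qed.

Let n0 : 0 < n%:R :> R.
Proof.
rewrite ltr0n lt0n; apply: contraTneq l0 => n0.
by rewrite /l n0 ln0 ?ltxx.
Qed.

Let expR_ln : expR l = n%:R.
Proof. by rewrite /l lnK. Qed.

Let l3 : 0 < l ^+ 3. Proof. exact: exprn_gt0. Qed.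

Let n_ge : 40 * l ^+ 3 <= n%:R.
Proof.
rewrite -expR_ln; apply: le_trans (expR_ge1Dxn 3 (ltW l0)).
have -> : 4`!%:R = 24 :> R by [].
rewrite exprS; have := ler_wpM2r (ltW l3) l_ge; move: l3; lra.
Qed.

Let D1 : 1 <= D%:R :> R. Proof. by rewrite ler1n. Qed.

Let A_ge : 40 <= A.
Proof. by rewrite /A ler_pdivlMr. Qed.

Let nE : n%:R = A * l ^+ 3.
Proof. by rewrite /A divfK // gt_eqF. Qed.

Let l5 : l ^+ 5 = l ^+ 2 * l ^+ 3. Proof. by rewrite -exprD. Qed.

(** The two bounds on [p] force D l^5 <= n. *)
Let A_geD : D%:R * l ^+ 2 <= A.
Proof.
have := le_trans p_ge p_le; rewrite ler_pdivrMr // mul1r nE l5 [D%:R * _]mulrA.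
by rewrite ler_pM2r.
Qed.

Let l2 : 1000 * l <= l ^+ 2.
Proof. by rewrite expr2 ler_wpM2r // ltW. Qed.

Let d_leA : D%:R * d%:R * 10 ^+ 6 <= A.
Proof.
have Dl : 0 < D%:R * l ^+ 5 by rewrite mulr_gt0 ?exprn_gt0 // ltr0n.
have := d_le; rewrite ler_pdivlMr // nE l5 [D%:R * _]mulrA [d%:R * _]mulrA ler_pM2r // => le1.
apply: le_trans le1; have le2 : 10 ^+ 6 <= l ^+ 2 by move: l2 l_ge; lra.
by have := ler_wpM2l (mulr_ge0 (ler0n R D) (ler0n R d)) le2; lra.
Qed.

Let d_leA' : d%:R * 10 ^+ 6 <= A.
Proof.
apply: le_trans d_leA; rewrite ler_wpM2r ?exprn_ge0 // ler_peMl //.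
Qed.

Let A0 : 0 <= A. Proof. by apply: le_trans A_ge; rewrite ler0n. Qed.

Let qA : D%:R * l ^+ 2 <= 2 * (q * A).
Proof.
have := p_ge; rewrite ler_pdivrMr // nE l5 [D%:R * _]mulrA [p * _]mulrA ler_pM2r // => le1.
have := ler_wpM2r A0 q_ge; lra.
Qed.

Let q0 : 0 <= q.
Proof.
apply: le_trans q_ge; rewrite divr_ge0 //; apply: le_trans p_ge.
by rewrite divr_ge0 ?mulr_ge0 ?exprn_ge0 // ltW.
Qed.

Let q_mul (k : nat) : A <= 4 * k%:R -> D%:R * l ^+ 2 <= 8 * (q * k%:R).
Proof. by move=> leA; have := ler_wpM2l q0 leA; move: qA; lra. Qed.

Let half_ge : A <= 2 * (m./2%:R) + 2.
Proof. exact: le_trans m_ge (natr_half_ge _ _). Qed.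

Let Dl_ge : 1000 * (D%:R * l) <= D%:R * l ^+ 2.
Proof. by have := ler_wpM2l (ler0n _ D) l2; lra. Qed.

Let Dl_ge' : l <= D%:R * l.
Proof. by rewrite ler_peMl // ltW. Qed.

Let Dl_geD : 1000 * D%:R <= D%:R * l.
Proof. by rewrite mulrC ler_wpM2l. Qed.

Lemma few_nbrs_small : 2 ^+ D * (1 - q / 2) ^+ (m - d) <= expR (- l) ^+ 6.
Proof.
have leA : A <= 4 * (m - d)%:R.
  have := natr_subr_le R m d; have := m_ge; rewrite -natr1 -/A.
  have := d_leA'; have := A_ge; lra.
have leq := q_mul leA.
(* 2 ^ D <= expR D, and D l^2 / 16 exceeds D + 6 l because l >= 1000. *)
apply: (@le_trans _ _ (expR D%:R * expR (- (D%:R * l ^+ 2 / 16)))).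
  apply: ler_pM; rewrite ?exprn_ge0 //.
  - by move: q_le; lra.
  - by rewrite -[D%:R]mul1r expRM_natr lerXn2r ?nnegrE ?expR_ge0 ?ler0n // expR_ge1Dx.
  - apply: exprn_le_expR; [by move: q0 q_le; lra|by move: leq; lra].
rewrite -expRD -expRM_natr ler_expR.
by have := Dl_ge; have := Dl_ge'; have := Dl_geD; have := l0; lra.
Qed.

Lemma few_parents_small : (1 - q) ^+ (m./2 - d) <= (expR (- l) ^+ 8) ^+ D.+1.
Proof.
have leA : A <= 4 * (m./2 - d)%:R.
  have := natr_subr_le R m./2 d; have := half_ge; have := d_leA'; have := A_ge; lra.
have leq := q_mul leA.
rewrite -exprM -expRM_natr mulNr; apply: exprn_le_expR; first by rewrite q0.
move: leq; rewrite natrM -natr1.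
by have := Dl_ge; have := l0; have := Dl_ge'; lra.
Qed.

Lemma many_parents_small :
  (1 - q) ^+ (m./2 %/ D - d) <= (expR (- l) ^+ 8) ^+ 2.
Proof.
(* Multiplied by [D], rounding costs at most [D] and the missing neighbours [D * d], both tiny
   against [A]. *)
have leA : A <= 4 * (D * (m./2 %/ D - d))%:R.
  have := ler_wpM2l (ler0n R D) (natr_subr_le R (m./2 %/ D) d); rewrite natrM.
  have := natr_divn_ge R m./2 D0.
  by have := half_ge; have := d_leA; have := A_ge; have := A_geD;
     have := Dl_ge; have := Dl_geD; lra.
have DR0 : 0 < D%:R :> R by rewrite ltr0n.
rewrite -!exprM -expRM_natr mulNr; apply: exprn_le_expR; first by rewrite q0.
have := q_mul leA; rewrite natrM [q * _]mulrCA [8 * _]mulrCA ler_pM2l // => le1.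
by move: le1 l2 l_ge; lra.
Qed.

(** With e = 1 / n, the first term is e^5 and the second at most 8 e^7. *)
Lemma failure_small :
  n%:R * expR (- l) ^+ 6
    + 2 * (((1 + expR (- l) ^+ 8) ^+ n - 1) * (1 + expR (- l) ^+ 8) ^+ n)
  <= n%:R ^- 4.
Proof.
set e := expR (- l).
have e0 : 0 < e by exact: expR_gt0.
have ne : n%:R * e = 1 by rewrite -expR_ln expRxMexpNx_1.
have -> : n%:R ^- 4 = e ^+ 4 by rewrite -expR_ln -exprVn -expRN.
have e1 : e <= 1 / 1000.
  have n1 : 1000 <= n%:R :> R.
    by rewrite -expR_ln; have := expR_ge1Dx l; move: l_ge; lra.
  have := ler_wpM2r (ltW e0) n1; rewrite ne; lra.
have nE8 : n%:R * e ^+ 8 = e ^+ 7 by rewrite exprS mulrA ne mul1r.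
have nE6 : n%:R * e ^+ 6 = e ^+ 5 by rewrite exprS mulrA ne mul1r.
have step k : e ^+ k.+1 <= e ^+ k / 1000.
  by rewrite exprSr; apply: ler_wpM2l; [apply/exprn_ge0/ltW|move: e1; lra].
have e40 : 0 <= e ^+ 4 by rewrite exprn_ge0 ?ltW.
have e70 : 0 <= e ^+ 7 by rewrite exprn_ge0 ?ltW.
have e80 : 0 <= e ^+ 8 by rewrite exprn_ge0 ?ltW.
have s4 := step 4%N; have s5 := step 5%N; have s6 := step 6%N.
have e7 : e ^+ 7 <= 1 / 2.
  have := step 0%N; have := step 1%N; have := step 2%N; have := step 3%N.
  by rewrite expr0; lra.
rewrite nE6.
have le1 : (1 + e ^+ 8) ^+ n <= 1 + 2 * e ^+ 7.
  by rewrite -nE8; apply: exprn_1D_le; rewrite // nE8; lra.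
have ge1 : 1 <= (1 + e ^+ 8) ^+ n by rewrite exprn_ege1 // lerDl.
set E := (1 + e ^+ 8) ^+ n in le1 ge1 *.
have : (E - 1) * E <= (2 * e ^+ 7) * 2 by apply: ler_pM; lra.
lra.
Qed.

End Numerics.

(** * Assembly with explicit constants *)

Unset Implicit Arguments.
Set Strict Implicit.

Theorem theorem3p1 (R : realType) :
  exists n0 : nat,
  forall (n Delta : nat) (U V : finType) (T : sgraph U) (v : U)
         (G : sgraph V) (x : V) (p : R),
    (n0 <= n)%N ->
    tree T -> #|U| = n -> max_degree T = Delta ->
    n%:R / (ln n%:R) ^+ 3 <= #|leaves T|%:R :> R ->
    #|V| = n ->
    n%:R - n%:R / (Delta%:R * (ln n%:R) ^+ 5) <= (min_degree G)%:R :> R ->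
    0 <= p <= 1 ->
    Delta%:R * (ln n%:R) ^+ 5 / n%:R <= p ->
    1 - n%:R ^- 4 <=
      Gp_prob G p (fun H =>
        [exists f : {ffun U -> V}, embedding T H f && (f v == x)]).
Proof.
(* This threshold ensures ln n >= 1000. *)
exists (Num.bound (expR (1000 : R))) => n D U V T v G x p n_ge treeT cardU degT
  leaves_ge cardV minG /andP[p0 p1] p_ge.
have n1000 : expR (1000 : R) < n%:R.
  by apply: lt_le_trans (archi_boundP (expR_ge0 _)) _; rewrite ler_nat.
have n0 : 0 < n%:R :> R by apply: lt_trans n1000; apply: expR_gt0.
have l_ge : 1000 <= ln n%:R :> R.
  by rewrite -ler_expR lnK ?ltW // posrE.
have D0 : (0 < D)%N.
  have : 0 < #|leaves T|%:R :> R.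
    apply: lt_le_trans leaves_ge; rewrite divr_gt0 // exprn_gt0 //.
    by apply: lt_le_trans l_ge; rewrite ltr0n.
  rewrite ltr0n => /card_gt0P[u]; rewrite inE => /eqP deg_u.
  by rewrite -degT /max_degree (bigD1 u) //= deg_u leq_max.
(* Removing [v] loses at most one leaf. *)
have m_ge : n%:R / ln n%:R ^+ 3 <= #|leaves T :\ v|.+1%:R :> R.
  apply: le_trans leaves_ge _; rewrite ler_nat (cardsD1 v (leaves T)).
  by rewrite -add1n leq_add2r leq_b1.
have minn : (min_degree G <= n)%N.
  by apply: leq_trans (min_degree_le G x) _; rewrite -cardV max_card.
have d_le : (n - min_degree G)%:R <= n%:R / (D%:R * ln n%:R ^+ 5) :> R.
  by rewrite natrB // lerBlDr addrC -lerBlDr.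
have few_missing a : (#|[set b | ~~ G a b]| <= n - min_degree G)%N.
  have -> : [set b | ~~ G a b] = ~: [set b | G a b] by apply/setP => b; rewrite !inE.
  by rewrite cardsCs setCK cardV leq_sub2l // min_degree_le.
pose q := 1 - Num.sqrt (1 - p).
have sq : (1 - q) ^+ 2 = 1 - p by rewrite /q opprB addrC subrK sqr_sqrtr // subr_ge0.
have q1 : q <= 1 by rewrite /q lerBlDr lerDl sqrtr_ge0.
(* 1 - p = (1 - q)^2 >= 1 - 2 q. *)
have q_ge : p / 2 <= q by move: sq (sqr_ge0 q); rewrite sqrrB expr1n mul1r; lra.
have q0 : 0 <= q by apply: le_trans q_ge; rewrite divr_ge0.
have q01 : 0 <= q <= 1 by rewrite q0.
have [rank [par [rank_inj rank_lt rank_v parP par_uniq]]] := tree_order v treeT.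
have e01 : 0 <= expR (- ln n%:R : R) ^+ 8 <= 1.
  rewrite exprn_ge0 ?expR_ge0 // exprn_ile1 ?expR_ge0 // expR_le1 oppr_le0.
  by apply: le_trans l_ge; rewrite ler0n.
have cardUV : #|U| = #|V| by rewrite cardU cardV.
rewrite Gp_prob_expect expect_union //.
(* The choices are eps = n^-6 and y = n^-8, with 1 / n written as expR (- ln n). *)
have := @embedding_expect R U V T G v x rank par q cardUV rank_inj rank_lt rank_v
  parP par_uniq q01 (n - min_degree G) (expR (- ln n%:R : R) ^+ 6)
  (expR (- ln n%:R : R) ^+ 8)
  _ few_missing e01.
rewrite degT cardU => /(_ _ _ _)/(le_trans _); apply.
- by rewrite -addrA -opprD lerB // failure_small.
- move=> a Y leY.
  apply: le_trans (few_nbrs_small l_ge D0 m_ge d_le p_ge q_ge q1).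
  apply: le_trans (few_nbrs_expect Y D q01 (few_missing a)) _.
  rewrite ler_wpM2l ?exprn_ge0 // ler_wiXn2l ?leq_sub2r //; lra.
- by apply: (few_parents_small l_ge D0 m_ge d_le p_ge q_ge q1).
- exact: many_parents_small l_ge D0 m_ge d_le p1 p_ge q_ge q1.
Qed.
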